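(* Let $H\Gamma=(C,\{\mathcal W,\mathcal X,\mathcal Y,\mathcal Z\},G_{zx},G_{wy})$ be a Lagrangian hypercube diagram. Then $H\Gamma$ determines an immersed torus $i:T=S^1\times S^1\to\mathbb{R}^4$ which is Lagrangian with respect to $\omega=dw\wedge dy+dz\wedge dx$; moreover the loops $\gamma_{zx}=S^1\times\{1\}$ and $\gamma_{wy}=\{1\}\times S^1$ map under $i$ to curves projecting to the Lagrangian grid diagrams $G_{zx}$ and $G_{wy}$ respectively.
   Context: Grid conventions. In a plane with coordinates $(a,b)$ (below $(a,b)=(w,y)$ or $(a,b)=(z,x)$), an immersed grid diagram of size $n$ is an $n\times n$ grid of unit cells in $[0,n]^2$ with two kinds of markings at centers of cells, each row and each column containing exactly one marking of each kind; joining each marking of the first kind to the marking of the second kind in its row by an $a$-parallel segment, and each marking of the second kind to the marking of the first kind in its column by a $b$-parallel segment, gives an oriented connected closed piecewise-linear curve, with no crossing information, viewed as an immersion $\gamma:\mathbb{R}/2\pi\mathbb{Z}\to\mathbb{R}^2$, $\theta\mapsto(a(\theta),b(\theta))$. It is a Lagrangian grid diagram if (1) $\int_0^{2\pi}b\,a'\,d\theta=0$ and (2) $\int_{\theta_0}^{\theta_1}b\,a'\,d\theta\neq0$ whenever $\theta_0\neq\theta_1$ and $\gamma(\theta_0)=\gamma(\theta_1)$. For a crossing $c=\gamma(\theta_0)=\gamma(\theta_1)$ put $|\Delta t(c)|=|\int_{\theta_0}^{\theta_1}b\,a'\,d\theta|$. Hypercube diagrams. Let $C=[0,n]^4$ with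 coordinates $(w,x,y,z)$. A flat is a product in which two coordinates range over $[0,n]$ and the other two over unit intervals $[k,k+1]$, named by its two full coordinates; a cube is a product in which three coordinates range over $[0,n]$ and one over a unit interval. Markings are points with coordinates in $\mathbb{Z}+\frac12$ labelled $W,X,Y,Z$. Marking conditions: each cube contains exactly one marking of each label; each cube contains exactly two flats containing exactly three markings; in each such flat the three markings form a right angle with rays parallel to coordinate axes; its vertex is $W$ iff the flat is a $zw$-flat, $X$ iff a $wx$-flat, $Y$ iff an $xy$-flat, $Z$ iff a $yz$-flat. Join each $W$ to an $X$ by a $w$-parallel segment, each $X$ to a $Y$ by an $x$-parallel segment, each $Y$ to a $Z$ by a $y$-parallel segment and each $Z$ to a $W$ by a $z$-parallel segment; the projections of this curve to the $(w,y)$- and $(z,x)$-planes are immersed grid diagrams $G_{wy}$ ($(a,b)=(w,y)$) and $G_{zx}$ ($(a,b)=(z,x)$). $H\Gamma$ is a Lagrangian hypercube diagram if the marking conditions hold, $G_{wy},G_{zx}$ are Lagrangian grid diagrams, and $|\Delta t(c)|\neq|\Delta t(c')|$ for all crossings $c$ of $G_{zx}$ and $c'$ of $G_{wy}$. The torus determined by $H\Gamma$ is obtained by placing a copy of $G_{zx}$ in each $zx$-flat whose $(w,y)$-cell contains a marking of $G_{wy}$ and joining these copies by the tubes swept out by translating them parallel to the $w$- and $y$-axes along the edges of $G_{wy}$; i.e. with $G_{zx}$ parametrized by $s\mapsto(z(s),x(s))$ and $G_{wy}$ by $u\mapsto(w(u),y(u))$, $i(s,u)=(w(u),x(s),y(u),z(s))$.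 *)

(* Defs.v *)
From Stdlib Require Import Reals ZArith.
From Coquelicot Require Import Coquelicot.
From mathcomp Require Import all_boot.

Set Implicit Arguments.
Unset Strict Implicit.
Unset Printing Implicit Defensive.
Local Open Scope nat_scope.

(* With these conventions, a marking of label l is joined to the next *)
(* marking (label l+1 mod 4) by a segment parallel to coordinate l.   *)
Definition c_w : 'I_4 := @Ordinal 4 0 erefl.
Definition c_x : 'I_4 := @Ordinal 4 1 erefl.
Definition c_y : 'I_4 := @Ordinal 4 2 erefl.
Definition c_z : 'I_4 := @Ordinal 4 3 erefl.
Definition l_W : 'I_4 := c_w.
Definition l_X : 'I_4 := c_x.
Definition l_Y : 'I_4 := c_y.
Definition l_Z : 'I_4 := c_z.

(* A unit 4-cell of C = [0,n]^4, [k_w,k_w+1] x ... x [k_z,k_z+1];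
   a marking sits at the center of such a cell. *)
Definition pt (n : nat) := {ffun 'I_4 -> 'I_n}.

Definition label_of (j : nat) : 'I_4 := inord (j %% 4).

Definition agree_except n (c : 'I_4) (p q : pt n) : Prop :=
  forall d : 'I_4, d != c -> p d = q d.

Definition differs_only n (c : 'I_4) (p q : pt n) : Prop :=
  agree_except c p q /\ p c != q c.

(* the flat with full coordinates a,b passing through the cell p,
   viewed as its set of unit cells *)
Definition flat_set n (a b : 'I_4) (p : pt n) : {set pt n} :=
  [set q : pt n | [forall d : 'I_4, ((d != a) && (d != b)) ==> (q d == p d)]].

(* the flats contained in the cube {coordinate c in [k,k+1]}; a flat is
   recorded together with its name (a,b), a < b, of full coordinates *)
Definition flats_in_cube n (c : 'I_4) (k : 'I_n) :
  {set ('I_4 * 'I_4) * {set pt n}} :=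
  [set ((x.1.1, x.1.2), flat_set x.1.1 x.1.2 x.2)
     | x : ('I_4 * 'I_4) * pt n
     & [&& (x.1.1 < x.1.2)%N, x.1.1 != c, x.1.2 != c & x.2 c == k]].

Definition marking_count n (M : 'I_4 -> {set pt n}) (F : {set pt n}) : nat :=
  #|[set lq : 'I_4 * pt n | (lq.2 \in M lq.1) && (lq.2 \in F)]|.

Definition vertex_rule (l a b : 'I_4) : Prop :=
  ((l == l_W) = ((a, b) == (c_w, c_z))) /\
  ((l == l_X) = ((a, b) == (c_w, c_x))) /\
  ((l == l_Y) = ((a, b) == (c_x, c_y))) /\
  ((l == l_Z) = ((a, b) == (c_y, c_z))).

(* the (three) markings of the flat fl form a right angle with rays
   parallel to the coordinate axes, with the prescribed vertex label *)
Definition right_angle n (M : 'I_4 -> {set pt n})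
    (fl : ('I_4 * 'I_4) * {set pt n}) : Prop :=
  let a := fl.1.1 in let b := fl.1.2 in let F := fl.2 in
  exists (l0 : 'I_4) (v : pt n) (l1 : 'I_4) (p1 : pt n) (l2 : 'I_4) (p2 : pt n),
    v \in M l0 /\ p1 \in M l1 /\ p2 \in M l2 /\
    v \in F /\ p1 \in F /\ p2 \in F /\
    differs_only a v p1 /\ differs_only b v p2 /\
    vertex_rule l0 a b.

Definition marking_conditions n (M : 'I_4 -> {set pt n}) : Prop :=
  (* each cube contains exactly one marking of each label *)
  (forall (l c : 'I_4) (k : 'I_n), #|[set p in M l | p c == k]| = 1) /\
  (* each cube contains exactly two flats containing exactly three markings *)
  (forall (c : 'I_4) (k : 'I_n),
      #|[set fl in flats_in_cube c k | marking_count M fl.2 == 3]| = 2) /\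
  (forall (c : 'I_4) (k : 'I_n) fl, fl \in flats_in_cube c k ->
      marking_count M fl.2 = 3 -> right_angle M fl).

(* cyc enumerates (periodically, period 4n) the oriented closed curve
   obtained by joining each W to an X by a w-parallel segment, each X to a
   Y by an x-parallel segment, each Y to a Z by a y-parallel segment and
   each Z to a W by a z-parallel segment; it passes through every marking,
   i.e. this curve is connected. *)
Definition joining_curve n (M : 'I_4 -> {set pt n}) (cyc : nat -> pt n) : Prop :=
  (forall j, cyc (j + 4 * n)%N = cyc j) /\
  (forall j, cyc j \in M (label_of j)) /\
  (forall (l : 'I_4) (p : pt n), p \in M l ->
      exists j, (j %% 4 = l)%N /\ cyc j = p) /\
  (forall j, agree_except (label_of j) (cyc j) (cyc j.+1)).

(* Grid diagrams in an (a,b)-plane. A grid diagram of size n is given  *)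
(* by the periodic (period 2n) sequence P of the cells of its markings *)
(* in the order in which the oriented curve visits them: P (2j) are    *)
(* the markings of the first kind, P (2j+1) those of the second kind;  *)
(* cells are pairs (a-index, b-index).                                 *)
Definition is_immersed_grid n (P : nat -> 'I_n * 'I_n) : Prop :=
  (forall i, P (i + 2 * n)%N = P i) /\
  (forall k : 'I_n,
      #|[set j : 'I_n | (P (2 * j)%N).2 == k]| = 1 /\
      #|[set j : 'I_n | (P (2 * j).+1).2 == k]| = 1 /\
      #|[set j : 'I_n | (P (2 * j)%N).1 == k]| = 1 /\
      #|[set j : 'I_n | (P (2 * j).+1).1 == k]| = 1) /\
  (* first kind -> second kind in its row (a-parallel segment),
     second kind -> first kind in its column (b-parallel segment) *)
  (forall j, (P (2 * j)%N).2 = (P (2 * j).+1).2 /\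
             (P (2 * j).+1).1 = (P (2 * j).+2).1) /\
  (* the segments are nondegenerate, so the curve is an immersion *)
  (forall j, P j <> P j.+1).

Definition wy_vert n (cyc : nat -> pt n) (i : nat) : 'I_n * 'I_n :=
  let p := cyc (if odd i then (4 * i./2).+1 else 4 * i./2)%N in (p c_w, p c_y).
Definition zx_vert n (cyc : nat -> pt n) (i : nat) : 'I_n * 'I_n :=
  let p := cyc (if odd i then 4 * i./2 + 4 else 4 * i./2 + 3)%N in (p c_z, p c_x).

Local Open Scope R_scope.

Definition center n (k : 'I_n) : R := INR k + / 2.

(* the oriented closed PL curve gamma : R/2piZ -> R^2 of a grid diagram:
   constant speed, the i-th segment (from P i to P (i+1)) is traversed
   for theta in [2 pi i / (2n), 2 pi (i+1) / (2n)]. *)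
Definition grid_param n (P : nat -> 'I_n * 'I_n) (th : R) : R * R :=
  let m := (2 * n)%N in
  let t := th * INR m / (2 * PI) in
  let k := Int_part t in
  let f := t - IZR k in
  let i := Z.to_nat (Z.modulo k (Z.of_nat m)) in
  ((1 - f) * center (P i).1 + f * center (P i.+1).1,
   (1 - f) * center (P i).2 + f * center (P i.+1).2).

Definition delta_t n (P : nat -> 'I_n * 'I_n) (th0 th1 : R) : R :=
  RInt (fun th => snd (grid_param P th) *
                  Derive (fun t => fst (grid_param P t)) th) th0 th1.

Definition crossing_params n (P : nat -> 'I_n * 'I_n) (th0 th1 : R) : Prop :=
  0 <= th0 < 2 * PI /\ 0 <= th1 < 2 * PI /\ th0 <> th1 /\
  grid_param P th0 = grid_param P th1.

Definition is_lagrangian_grid n (P : nat -> 'I_n * 'I_n) : Prop :=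
  is_immersed_grid P /\
  delta_t P 0 (2 * PI) = 0 /\
  (forall th0 th1, crossing_params P th0 th1 -> delta_t P th0 th1 <> 0).

(* Lagrangian hypercube diagram with markings M (M l = markings of label l)
   and hypercube curve cyc; G_zx = zx_vert cyc, G_wy = wy_vert cyc. *)
Definition lagrangian_hypercube n (M : 'I_4 -> {set pt n}) (cyc : nat -> pt n)
  : Prop :=
  marking_conditions M /\
  joining_curve M cyc /\
  is_lagrangian_grid (zx_vert cyc) /\
  is_lagrangian_grid (wy_vert cyc) /\
  (forall th0 th1 ph0 ph1,
      crossing_params (zx_vert cyc) th0 th1 ->
      crossing_params (wy_vert cyc) ph0 ph1 ->
      Rabs (delta_t (zx_vert cyc) th0 th1) <> Rabs (delta_t (wy_vert cyc) ph0 ph1)).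

(* The torus i(s,u) = (w(u), x(s), y(u), z(s)), with                  *)
(* gamma_zx(s) = (z(s),x(s)) and gamma_wy(u) = (w(u),y(u)).            *)
Definition torus_map n (cyc : nat -> pt n) (s u : R) (c : 'I_4) : R :=
  let zx := grid_param (zx_vert cyc) s in
  let wy := grid_param (wy_vert cyc) u in
  if c == c_w then fst wy else if c == c_x then snd zx
  else if c == c_y then snd wy else fst zx.

Definition omega (U V : 'I_4 -> R) : R :=
  U c_w * V c_y - U c_y * V c_w + U c_z * V c_x - U c_x * V c_z.

Definition d_s (i : R -> R -> 'I_4 -> R) (s u : R) (c : 'I_4) : R :=
  Derive (fun s' => i s' u c) s.
Definition d_u (i : R -> R -> 'I_4 -> R) (s u : R) (c : 'I_4) : R :=
  Derive (fun u' => i s u' c) u.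

Definition differentiable_at (i : R -> R -> 'I_4 -> R) (s u : R) : Prop :=
  forall c : 'I_4, ex_derive (fun s' => i s' u c) s /\ ex_derive (fun u' => i s u' c) u.

(* i : R^2 -> R^4 (2pi-periodic in both variables, i.e. a map
   S^1 x S^1 -> R^4) is a (piecewise-linear) immersed torus which is
   Lagrangian for omega: it is locally injective, and at every point
   where it is differentiable its differential has rank 2 and its
   image is an omega-isotropic (hence Lagrangian) plane. *)
Definition immersed_lagrangian_torus (i : R -> R -> 'I_4 -> R) : Prop :=
  (forall s u c, i (s + 2 * PI) u c = i s u c /\ i s (u + 2 * PI) c = i s u c) /\
  (forall s u, exists eps, 0 < eps /\
     forall s1 u1 s2 u2,
       Rabs (s1 - s) < eps -> Rabs (u1 - u) < eps ->
       Rabs (s2 - s) < eps -> Rabs (u2 - u) < eps ->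
       (forall c, i s1 u1 c = i s2 u2 c) -> s1 = s2 /\ u1 = u2) /\
  (forall s u, differentiable_at i s u ->
     forall a b : R, (forall c, a * d_s i s u c + b * d_u i s u c = 0) ->
       a = 0 /\ b = 0) /\
  (forall s u, differentiable_at i s u -> omega (d_s i s u) (d_u i s u) = 0).

(* Main.v *)
Require Import Defs.
From Stdlib Require Import Reals Lra Lia ZArith.
From Coquelicot Require Import Coquelicot.
From mathcomp Require Import all_boot zify.

(* The torus is the product i(s,u) = (w(u), x(s), y(u), z(s)) of the two grid
   curves.  Its s-derivative lies in the (z,x)-plane and its u-derivative in
   the (w,y)-plane, and omega = dw/\dy + dz/\dx pairs each of these planes only
   with itself, so the torus is isotropic, i.e. Lagrangian.  Local injectivity
   and the rank condition reduce to the same facts for each grid curve, a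
   constant-speed polygon whose nondegenerate segments alternate between the
   two axis directions. *)

Set Implicit Arguments.
Unset Strict Implicit.
Open Scope R_scope.

Lemma Int_part_bounds r : IZR (Int_part r) <= r < IZR (Int_part r) + 1.
Proof. have [h1 h2] := base_Int_part r; lra. Qed.

Lemma Int_part_unique r z : IZR z <= r < IZR z + 1 -> Int_part r = z.
Proof. by move=> h; symmetry; apply: Int_part_spec; lra. Qed.

Lemma center_inj n : injective (@center n).
Proof. by move=> a b; rewrite /center => h; apply: ord_inj; apply: INR_eq; lra. Qed.

Lemma center_pair_neq n (a b : 'I_n * 'I_n) : a <> b ->
  center a.1 <> center b.1 \/ center a.2 <> center b.2.
Proof.
case: a b => [a1 a2] [b1 b2] /= ab.
have [/center_inj e1 | ] := Req_dec (center a1) (center b1); last by left.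
by right=> /center_inj e2; apply: ab; rewrite e1 e2.
Qed.

Lemma is_derive_right_affine (F : R -> R) x l s d : is_derive F x l -> 0 < d ->
  (forall h, 0 < h < d -> F (x + h) = F x + h * s) -> l = s.
Proof.
move=> /is_derive_Reals dF d0 Faff.
have [//|ls] := Req_dec l s.
have [del Hdel] := dF _ (Rabs_pos_lt (l - s) ltac:(lra)).
have m0 : 0 < Rmin del d by apply: Rmin_pos; [apply: cond_pos | lra].
pose h := Rmin del d / 2.
have h0 : 0 < h by rewrite /h; lra.
have [hdel hd] : h < del /\ h < d.
  by split; [apply: Rlt_le_trans (Rmin_l del d) | apply: Rlt_le_trans (Rmin_r del d)];
     rewrite /h; lra.
have := Hdel h ltac:(lra) ltac:(rewrite Rabs_pos_eq; lra).
rewrite Faff; last lra.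
replace ((F x + h * s - F x) / h) with s by (field; lra).
rewrite Rabs_minus_sym; lra.
Qed.

Lemma periodic_eq_mod (T : Type) (m : nat) (P : nat -> T) : (0 < m)%N ->
  (forall i, P (i + m)%N = P i) ->
  forall a b : nat, (Z.of_nat a mod Z.of_nat m = Z.of_nat b mod Z.of_nat m)%Z ->
  P a = P b.
Proof.
move=> m0 Pm.
have Pmq r q : P (r + m * q)%N = P r.
  elim: q => [|q IH]; first by rewrite muln0 addn0.
  by rewrite mulnS addnCA addnC Pm.
have Pmod a : P a = P (Z.to_nat (Z.of_nat a mod Z.of_nat m)).
  rewrite -Nat2Z.inj_mod Nat2Z.id {1}(Nat.div_mod_eq a m).
  by rewrite -[RHS](Pmq _ (Nat.div a m)); congr P; lia.
by move=> a b e; rewrite Pmod e -Pmod.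
Qed.

Section GridCurve.
Variables (n : nat) (P : nat -> 'I_n * 'I_n).

Lemma grid_size_pos : (0 < n)%N.
Proof. exact: leq_ltn_trans (leq0n _) (ltn_ord (P 0%N).1). Qed.

(* The curve runs through one segment per unit of [grid_time]. *)
Definition grid_time (th : R) : R := th * INR (2 * n)%N / (2 * PI).
Definition segment_index (k : Z) : nat := Z.to_nat (k mod Z.of_nat (2 * n)%N).
Definition grid_segment (k : Z) (f : R) : R * R :=
  ((1 - f) * center (P (segment_index k)).1 + f * center (P (segment_index k).+1).1,
   (1 - f) * center (P (segment_index k)).2 + f * center (P (segment_index k).+1).2).

Lemma grid_paramE th : grid_param P th =
  grid_segment (Int_part (grid_time th)) (grid_time th - IZR (Int_part (grid_time th))).
Proof. by []. Qed.

Lemma grid_time_pos_rate : 0 < INR (2 * n)%N / (2 * PI).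
Proof.
have := grid_size_pos; have := PI_RGT_0 => PI0 n0.
by apply: Rdiv_lt_0_compat; [apply: lt_0_INR; lia | lra].
Qed.

Lemma grid_timeD th h : grid_time (th + h) = grid_time th + h * (INR (2 * n)%N / (2 * PI)).
Proof. by rewrite /grid_time; have := PI_RGT_0 => PI0; field; lra. Qed.

Lemma grid_param_periodic th : grid_param P (th + 2 * PI) = grid_param P th.
Proof.
have shift : grid_time (th + 2 * PI) = grid_time th + IZR (Z.of_nat (2 * n)%N).
  by rewrite grid_timeD -INR_IZR_INZ; have := PI_RGT_0 => PI0; field; lra.
have Ishift : Int_part (grid_time (th + 2 * PI))
              = (Int_part (grid_time th) + 1 * Z.of_nat (2 * n)%N)%Z.
  by apply: Int_part_unique; rewrite shift plus_IZR Z.mul_1_l;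
     have := Int_part_bounds (grid_time th); lra.
rewrite !grid_paramE Ishift shift plus_IZR /grid_segment /segment_index Z_mod_plus_full.
by rewrite Z.mul_1_l; do 2 f_equal; ring.
Qed.

Hypothesis P_grid : is_immersed_grid P.

Lemma segment_indexD k (j : nat) :
  P (segment_index k + j)%N = P (segment_index (k + Z.of_nat j)).
Proof.
have [Pper _] := P_grid; have n0 := grid_size_pos.
apply: (periodic_eq_mod (m := (2 * n)%N)) => //; first lia.
have m0 : (0 < Z.of_nat (2 * n)%N)%Z by lia.
have [h1 _] := Z.mod_pos_bound k _ m0.
have [h3 _] := Z.mod_pos_bound (k + Z.of_nat j) _ m0.
by rewrite /segment_index Nat2Z.inj_add !Z2Nat.id // Zplus_mod_idemp_l Z.mod_mod; lia.
Qed.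

Lemma immersed_grid_alternates i :
  ((P i).2 = (P i.+1).2 /\ (P i.+1).1 = (P i.+2).1) \/
  ((P i).1 = (P i.+1).1 /\ (P i.+1).2 = (P i.+2).2).
Proof.
have [_ [_ [Hseg _]]] := P_grid.
have [[j ->]|[j ->]] := Nat.Even_or_Odd i.
  by left; rewrite -[(2 * j)%coq_nat]/(2 * j)%N; apply: Hseg.
have -> : (2 * j + 1)%coq_nat = (2 * j).+1 by lia.
have [_ h2] := Hseg j; have [h1 _] := Hseg j.+1.
by right; rewrite mulnS add2n in h1.
Qed.

Lemma grid_segment_inj k f1 f2 : grid_segment k f1 = grid_segment k f2 -> f1 = f2.
Proof.
have [_ [_ [_ Hnd]]] := P_grid.
have := center_pair_neq (Hnd (segment_index k)); rewrite /grid_segment.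
set A := P (segment_index k); set B := P (segment_index k).+1.
move=> [ne|ne] [e1 e2].
  have /Rmult_integral : (f1 - f2) * (center B.1 - center A.1) = 0 by lra.
  by case; lra.
have /Rmult_integral : (f1 - f2) * (center B.2 - center A.2) = 0 by lra.
by case; lra.
Qed.

(* Consecutive segments are perpendicular, so they meet only at their common
   endpoint, which the first one reaches at [f = 1]. *)
Lemma grid_segment_next_neq k f1 f2 : f1 < 1 ->
  grid_segment k f1 <> grid_segment (k + 1) f2.
Proof.
move=> f1lt1.
have [_ [_ [_ Hnd]]] := P_grid.
have E1 : P (segment_index (k + 1)) = P (segment_index k).+1.
  by rewrite -addn1 segment_indexD.
have E2 : P (segment_index (k + 1)).+1 = P (segment_index k).+2.
  by rewrite -addn1 segment_indexD -addn2 segment_indexD -Z.add_assoc.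
have := immersed_grid_alternates (segment_index k).
have := Hnd (segment_index k).
rewrite /grid_segment E1 E2.
set A := P (segment_index k); set B := P (segment_index k).+1.
set C := P (segment_index k).+2.
move=> AB [[a1 a2]|[a1 a2]] [e1 e2].
- have ne : center A.1 <> center B.1.
    by move=> /center_inj e; apply: AB; rewrite [A]surjective_pairing e a1 -surjective_pairing.
  rewrite -a2 in e1.
  have /Rmult_integral : (1 - f1) * (center A.1 - center B.1) = 0 by lra.
  by case; lra.
- have ne : center A.2 <> center B.2.
    by move=> /center_inj e; apply: AB; rewrite [A]surjective_pairing e a1 -surjective_pairing.
  rewrite -a2 in e2.
  have /Rmult_integral : (1 - f1) * (center A.2 - center B.2) = 0 by lra.
  by case; lra.
Qed.

Lemma grid_segment_time_inj t1 t2 : Rabs (t1 - t2) < 1 ->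
  grid_segment (Int_part t1) (t1 - IZR (Int_part t1)) =
  grid_segment (Int_part t2) (t2 - IZR (Int_part t2)) -> t1 = t2.
Proof.
move=> /Rabs_def2 [lt1 gt1] E.
have b1 := Int_part_bounds t1; have b2 := Int_part_bounds t2.
have d12 : (Int_part t1 - Int_part t2 < 2)%Z by apply: lt_IZR; rewrite minus_IZR; lra.
have d21 : (Int_part t2 - Int_part t1 < 2)%Z by apply: lt_IZR; rewrite minus_IZR; lra.
have [lt|[eq|gt]] := Z.lt_total (Int_part t1) (Int_part t2).
- have e : Int_part t2 = (Int_part t1 + 1)%Z by lia.
  by rewrite e in E; case: (grid_segment_next_neq _ E); lra.
- by rewrite eq in E b1; have := grid_segment_inj E; lra.
- have e : Int_part t1 = (Int_part t2 + 1)%Z by lia.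
  by rewrite e in E; case: (grid_segment_next_neq _ (esym E)); lra.
Qed.

Lemma grid_time_sub th1 th2 :
  grid_time th1 - grid_time th2 = (th1 - th2) * (INR (2 * n)%N / (2 * PI)).
Proof. by rewrite /grid_time; have := PI_RGT_0 => PI0; field; lra. Qed.

Lemma grid_param_locally_injective th th1 th2 :
  Rabs (th1 - th) < PI / INR (2 * n)%N -> Rabs (th2 - th) < PI / INR (2 * n)%N ->
  grid_param P th1 = grid_param P th2 -> th1 = th2.
Proof.
move=> h1 h2; rewrite !grid_paramE => /grid_segment_time_inj E.
have := PI_RGT_0 => PI0; have := grid_time_pos_rate => r0.
have m0 : 0 < INR (2 * n)%N by apply: lt_0_INR; have := grid_size_pos; lia.
have d12 : Rabs (th1 - th2) < 2 * (PI / INR (2 * n)%N).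
  rewrite Rabs_minus_sym in h2.
  have := Rabs_triang (th1 - th) (th - th2).
  have -> : th1 - th + (th - th2) = th1 - th2 by ring.
  lra.
set r := INR (2 * n)%N / (2 * PI) in r0.
have /Rmult_integral [|] : (th1 - th2) * r = 0.
- rewrite -grid_time_sub E ?Rminus_diag //.
  rewrite grid_time_sub Rabs_mult (Rabs_pos_eq r); last lra.
  have -> : 1 = 2 * (PI / INR (2 * n)%N) * r by rewrite /r; field; lra.
  by apply: Rmult_lt_compat_r.
- lra.
- lra.
Qed.

Lemma grid_param_right_segment th h :
  let t := grid_time th in let k := Int_part t in
  let r := INR (2 * n)%N / (2 * PI) in
  0 < h < (1 - (t - IZR k)) / r ->
  grid_param P (th + h) = grid_segment k (t - IZR k + h * r).
Proof.
move=> t k r [h0 hlt].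
have r0 : 0 < r := grid_time_pos_rate.
have hr : h * r < 1 - (t - IZR k).
  have := Rmult_lt_compat_r r _ _ r0 hlt.
  by have -> : (1 - (t - IZR k)) / r * r = 1 - (t - IZR k) by field; lra.
have kb : IZR k <= t < IZR k + 1 := Int_part_bounds t.
have hr0 := Rmult_lt_0_compat _ _ h0 r0.
have Ik : Int_part (grid_time (th + h)) = k.
  by apply: Int_part_unique; rewrite grid_timeD -/t -/r; lra.
by rewrite grid_paramE Ik grid_timeD -/t -/r; congr grid_segment; ring.
Qed.

Lemma grid_param_velocity_neq0 th :
  ex_derive (fun t => fst (grid_param P t)) th ->
  ex_derive (fun t => snd (grid_param P t)) th ->
  Derive (fun t => fst (grid_param P t)) th <> 0 \/
  Derive (fun t => snd (grid_param P t)) th <> 0.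
Proof.
move=> d1 d2.
have r0 := grid_time_pos_rate.
set t := grid_time th; set k := Int_part t; set r := INR (2 * n)%N / (2 * PI) in r0.
have kb := Int_part_bounds t.
have dpos : 0 < (1 - (t - IZR k)) / r by apply: Rdiv_lt_0_compat; rewrite /k; lra.
have seg := grid_param_right_segment (th := th).
have at_th : grid_param P th = grid_segment k (t - IZR k) by rewrite grid_paramE.
have [_ [_ [_ Hnd]]] := P_grid.
have := center_pair_neq (Hnd (segment_index k)).
have D1 : Derive (fun t => fst (grid_param P t)) th
           = r * (center (P (segment_index k).+1).1 - center (P (segment_index k)).1).
  apply: (is_derive_right_affine (Derive_correct _ _ d1) dpos) => h hh.
  by rewrite seg // at_th /grid_segment /= /r /k /t; ring.
have D2 : Derive (fun t => snd (grid_param P t)) th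
           = r * (center (P (segment_index k).+1).2 - center (P (segment_index k)).2).
  apply: (is_derive_right_affine (Derive_correct _ _ d2) dpos) => h hh.
  by rewrite seg // at_th /grid_segment /= /r /k /t; ring.
rewrite D1 D2 => -[ne|ne]; [left|right]; by move=> /Rmult_integral [|]; lra.
Qed.

End GridCurve.

Section Torus.
Variables (n : nat) (cyc : nat -> pt n).

Notation gamma_zx := (grid_param (zx_vert cyc)).
Notation gamma_wy := (grid_param (wy_vert cyc)).

Lemma torus_map_periodic s u c :
  torus_map cyc (s + 2 * PI) u c = torus_map cyc s u c /\
  torus_map cyc s (u + 2 * PI) c = torus_map cyc s u c.
Proof. by rewrite /torus_map !grid_param_periodic. Qed.

Lemma d_s_torus_map_w s u : d_s (torus_map cyc) s u c_w = 0.
Proof. exact: Derive_const. Qed.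
Lemma d_s_torus_map_y s u : d_s (torus_map cyc) s u c_y = 0.
Proof. exact: Derive_const. Qed.
Lemma d_u_torus_map_x s u : d_u (torus_map cyc) s u c_x = 0.
Proof. exact: Derive_const. Qed.
Lemma d_u_torus_map_z s u : d_u (torus_map cyc) s u c_z = 0.
Proof. exact: Derive_const. Qed.

(* The s-derivative lies in the zx-plane and the u-derivative in the wy-plane,
   which are omega-orthogonal. *)
Lemma torus_map_isotropic s u :
  omega (d_s (torus_map cyc) s u) (d_u (torus_map cyc) s u) = 0.
Proof.
rewrite /omega d_s_torus_map_w d_s_torus_map_y d_u_torus_map_x d_u_torus_map_z; ring.
Qed.

Hypotheses (zx_grid : is_immersed_grid (zx_vert cyc))
           (wy_grid : is_immersed_grid (wy_vert cyc)).

Lemma torus_map_locally_injective s u : exists eps, 0 < eps /\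
  forall s1 u1 s2 u2,
    Rabs (s1 - s) < eps -> Rabs (u1 - u) < eps ->
    Rabs (s2 - s) < eps -> Rabs (u2 - u) < eps ->
    (forall c, torus_map cyc s1 u1 c = torus_map cyc s2 u2 c) -> s1 = s2 /\ u1 = u2.
Proof.
have n0 := grid_size_pos (zx_vert cyc).
exists (PI / INR (2 * n)%N); split.
  by apply: Rdiv_lt_0_compat; [exact: PI_RGT_0 | apply: lt_0_INR; lia].
move=> s1 u1 s2 u2 hs1 hu1 hs2 hu2 E.
have Ez : (gamma_zx s1).1 = (gamma_zx s2).1 := E c_z.
have Ex : (gamma_zx s1).2 = (gamma_zx s2).2 := E c_x.
have Ew : (gamma_wy u1).1 = (gamma_wy u2).1 := E c_w.
have Ey : (gamma_wy u1).2 = (gamma_wy u2).2 := E c_y.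
split.
  apply: (grid_param_locally_injective zx_grid hs1 hs2).
  by rewrite [gamma_zx s1]surjective_pairing [gamma_zx s2]surjective_pairing Ez Ex.
apply: (grid_param_locally_injective wy_grid hu1 hu2).
by rewrite [gamma_wy u1]surjective_pairing [gamma_wy u2]surjective_pairing Ew Ey.
Qed.

Lemma torus_map_rank2 s u : differentiable_at (torus_map cyc) s u ->
  forall a b : R, (forall c, a * d_s (torus_map cyc) s u c + b * d_u (torus_map cyc) s u c = 0) ->
  a = 0 /\ b = 0.
Proof.
move=> D a b Hab.
have scale_eq0 (x v1 v2 : R) : x * v1 = 0 -> x * v2 = 0 -> v1 <> 0 \/ v2 <> 0 -> x = 0.
  by move=> /Rmult_integral [|->] // /Rmult_integral [|->] // [].
have hx := Hab c_x; have hz := Hab c_z; have hw := Hab c_w; have hy := Hab c_y.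
rewrite d_u_torus_map_x Rmult_0_r Rplus_0_r in hx.
rewrite d_u_torus_map_z Rmult_0_r Rplus_0_r in hz.
rewrite d_s_torus_map_w Rmult_0_r Rplus_0_l in hw.
rewrite d_s_torus_map_y Rmult_0_r Rplus_0_l in hy.
split.
  exact: scale_eq0 hz hx (grid_param_velocity_neq0 zx_grid (D c_z).1 (D c_x).1).
exact: scale_eq0 hw hy (grid_param_velocity_neq0 wy_grid (D c_w).2 (D c_y).2).
Qed.

Lemma immersed_lagrangian_torus_map : immersed_lagrangian_torus (torus_map cyc).
Proof.
split; first exact: torus_map_periodic.
split; first exact: torus_map_locally_injective.
by split=> [|s u _]; [exact: torus_map_rank2 | exact: torus_map_isotropic].
Qed.

End Torus.

Theorem theorem5p1 (n : nat) (M : 'I_4 -> {set pt n}) (cyc : nat -> pt n) :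
  lagrangian_hypercube M cyc ->
  immersed_lagrangian_torus (torus_map cyc) /\
  (forall s : R, (torus_map cyc s R0 c_z, torus_map cyc s R0 c_x)
                 = grid_param (zx_vert cyc) s) /\
  (forall u : R, (torus_map cyc R0 u c_w, torus_map cyc R0 u c_y)
                 = grid_param (wy_vert cyc) u).
Proof.
move=> [_ [_ [[zx_grid _] [[wy_grid _] _]]]].
split; first exact: immersed_lagrangian_torus_map.
by split=> t; rewrite [RHS]surjective_pairing.
Qed.
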